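(* Let $V,W,g,\mu,\gamma_*,\Phi,\mathcal{L}(\gamma),\mathcal{L}^*(\gamma)$ be as in the context and let $\gamma_0\in(-\gamma_*,\gamma_* )$. Suppose that for $\gamma=\gamma_0$ there exists an isolated defective eigenvalue $\lambda_0=i\Omega_0\in i\mathbb{R}\setminus\{0\}$ of the spectral problem $\mathcal{L}(\gamma_0)v=-i\lambda\sigma_3v$ and of the adjoint spectral problem $\mathcal{L}^*(\gamma_0)v^\#=-i\lambda\sigma_3v^\#$, of geometric multiplicity one and algebraic multiplicity two, with eigenvector $v_0$, generalized eigenvector $v_g$, adjoint eigenvector $v_0^\#$ and adjoint generalized eigenvector $v_g^\#$, all in $D(L_0)\times D(L_0)$, satisfying $$\mathcal{L}(\gamma_0)v_0=\Omega_0\sigma_3v_0,\quad \mathcal{L}(\gamma_0)v_g=\Omega_0\sigma_3v_g+\sigma_3v_0,$$ $$\mathcal{L}^*(\gamma_0)v_0^\#=\Omega_0\sigma_3v_0^\#,\quad \mathcal{L}^*(\gamma_0)v_g^\#=\Omega_0\sigma_3v_g^\#+\sigma_3v_0^\#.$$ Then $$K(\lambda_0)=\langle v_0,\sigma_3v_0^\#\rangle=0$$ and $$\langle v_g,\sigma_3v_0^\#\rangle=\langle v_0,\sigma_3v_g^\#\rangle\neq0 .$$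
   Context: Setting. $V,W:\mathbb{R}\to\mathbb{R}$ satisfy $V(-x)=V(x)$, $W(-x)=-W(x)$; $g\in\{+1,-1\}$; $\mu\in\mathbb{R}$ is fixed. (A1) The operator $L_0=-\partial_x^2+V(x)$ in $L^2(\mathbb{R})$ admits a self-adjoint extension with dense domain $D(L_0)\subset L^2(\mathbb{R})$ (again denoted $L_0$). (A2) $W$ is bounded and $|W(x)|\le Ce^{-\kappa|x|}$ for all $x\in\mathbb{R}$, for some $C,\kappa>0$. (A3) There is $\gamma_*>0$ such that for every $\gamma\in(-\gamma_*,\gamma_* )$ there is a bounded, decaying solution $\Phi=\Phi(\gamma)\in D(L_0)$ of $$-\Phi''+(V+i\gamma W)\Phi-g|\Phi|^2\Phi=\mu\Phi,$$ with $\Phi(x)=\overline{\Phi(-x)}$ and $|\Phi(x)|\le Ce^{-\kappa|x|}$ for all $x\in\mathbb{R}$, for some $C,\kappa>0$; moreover $\gamma\mapsto\Phi\in D(L_0)$ is real-analytic on $(-\gamma_*,\gamma_* )$. Operators. With $\sigma_3=\mathrm{diag}(1,-1)$, define on $D(L_0)\times D(L_0)\subset L^2(\mathbb{R})\times L^2(\mathbb{R})$ $$\mathcal{L}(\gamma)=\begin{bmatrix} -\partial_x^2+V+i\gamma W-\mu-2g|\Phi|^2 & -g\Phi^2\\ -g\overline{\Phi}^2 & -\partial_x^2+V-i\gamma W-\mu-2g|\Phi|^2\end{bmatrix},$$ $$\mathcal{L}^*(\gamma)=\begin{bmatrix} -\partial_x^2+V-i\gamma W-\mu-2g|\Phi|^2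 & -g\Phi^2\\ -g\overline{\Phi}^2 & -\partial_x^2+V+i\gamma W-\mu-2g|\Phi|^2\end{bmatrix}.$$ $\lambda\in\mathbb{C}$ is an eigenvalue of the spectral problem $\mathcal{L}v=-i\lambda\sigma_3v$ if there is a nonzero solution $v\in D(L_0)\times D(L_0)$; equivalently, $\lambda$ is an eigenvalue of $i\sigma_3\mathcal{L}$. Isolatedness and algebraic multiplicity refer to $i\sigma_3\mathcal{L}$ (isolated point of its spectrum; rank of the Riesz projection); defective means algebraic multiplicity exceeds geometric multiplicity. The same conventions apply to the adjoint problem. Inner product: $\langle (f_1,f_2),(h_1,h_2)\rangle=\int_{\mathbb{R}}(f_1\overline{h_1}+f_2\overline{h_2})\,dx$. The Krein quantity of $\lambda_0$ is $K(\lambda_0)=\langle v_0,\sigma_3v_0^\#\rangle$. *)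

(* Defs.v *)
From mathcomp Require Import all_boot all_order all_algebra.
From mathcomp Require Import all_classical all_reals all_analysis.
From mathcomp Require Export complex.

Set Implicit Arguments.
Unset Strict Implicit.
Unset Printing Implicit Defensive.

Import Order.TTheory GRing.Theory Num.Theory.
Import numFieldNormedType.Exports.

Local Open Scope classical_set_scope.
Local Open Scope ring_scope.
Local Open Scope complex_scope.

(* L^2(R) = L^2(R; C) is handled through representatives: its elements are
   functions R -> R[i] satisfying [L2], identified when equal almost everywhere
   for Lebesgue measure ([aeq]).  Likewise for L^2(R) x L^2(R). *)

Definition cfun (R : realType) : Type := R -> R[i].
Definition cfun2 (R : realType) : Type := (cfun R * cfun R)%type.

Section ScalarL2.
Variable R : realType.
Implicit Types (D : set (cfun R)) (f h k : cfun R).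

Definition cintegral (E : set R) f : R[i] :=
  (\int[@lebesgue_measure R]_(x in E) complex.Re (f x)) +i*
  (\int[@lebesgue_measure R]_(x in E) complex.Im (f x)).

Definition L2 f : Prop :=
  ((fun x : measurableTypeR R => complex.Re (f x)) \in Lfun (@lebesgue_measure R) 2%:E)
  /\ ((fun x : measurableTypeR R => complex.Im (f x))
        \in Lfun (@lebesgue_measure R) 2%:E).

Definition aeq f h : Prop := f = h %[ae @lebesgue_measure R].

Definition inner f h : R[i] := cintegral setT (fun x => f x * conjc (h x)).

Definition L2norm f : R := Num.sqrt (complex.Re (inner f f)).

(* An (unbounded) linear operator in L^2(R) with domain [D]; the values of [A]
   outside [D] are irrelevant. *)
Definition is_operator D (A : cfun R -> cfun R) : Prop :=
  [/\ forall f, D f -> L2 f /\ L2 (A f),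
      D (fun=> 0),
      forall f h, D f -> L2 h -> aeq f h -> D h /\ aeq (A f) (A h)
    & forall (c : R[i]) f h, D f -> D h ->
        D (fun x => c * f x + h x) /\
        aeq (A (fun x => c * f x + h x)) (fun x => c * A f x + A h x)].

Definition dense_domain D : Prop :=
  forall f, L2 f -> forall e : R, 0 < e ->
    exists2 h, D h & L2norm (fun x => f x - h x) < e.

(* [(h, k)] belongs to the graph of the adjoint of [(D, A)] *)
Definition adjoint_graph D (A : cfun R -> cfun R) h k : Prop :=
  [/\ L2 h, L2 k & forall f, D f -> inner (A f) h = inner f k].

Definition self_adjoint D (A : cfun R -> cfun R) : Prop :=
  [/\ is_operator D A, dense_domain D
    & forall h k, adjoint_graph D A h k <-> [/\ D h, L2 k & aeq (A h) k]].

(* [f] has compact support, [f] and [f'] are locally absolutely continuous with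
   [f'' = f2] a.e., and [- f2 + V f] is in L^2(R): the domain of the
   (pre)minimal operator of the differential expression [- d^2/dx^2 + V]. *)
Definition schrodinger_core (V : R -> R) f (f2 : cfun R) : Prop :=
  (exists r : R, forall x, r < `|x| -> f x = 0) /\
  locally_integrable setT (fun x => complex.Re (f2 x)) /\
  locally_integrable setT (fun x => complex.Im (f2 x)) /\
  (exists f1 : cfun R,
    (forall x : R, is_derive x 1 (fun y : R => complex.Re (f y)) (complex.Re (f1 x)) /\
                   is_derive x 1 (fun y : R => complex.Im (f y)) (complex.Im (f1 x))) /\
    (forall a b : R, a <= b -> f1 b - f1 a = cintegral `[a, b] f2)) /\
  L2 (fun x => - f2 x + (V x)%:C * f x).

Definition extends_schrodinger (V : R -> R) D (A : cfun R -> cfun R) : Prop :=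
  forall f f2, schrodinger_core V f f2 ->
    D f /\ aeq (A f) (fun x => - f2 x + (V x)%:C * f x).

Definition exp_decay f : Prop :=
  exists C kappa : R, [/\ 0 < C, 0 < kappa
    & forall x, `|f x| <= (C * expR (- kappa * `|x|))%:C].

(* Real-analyticity on ]-gs, gs[ of a map with values in the domain [D] of [A],
   equipped with the graph norm. *)
Definition real_analytic_in_domain D (A : cfun R -> cfun R) (gs : R)
    (Phi : R -> cfun R) : Prop :=
  forall c : R, c \in `]- gs, gs[ ->
  exists (delta : R) (a : nat -> cfun R), 0 < delta /\ (forall n, D (a n)) /\
    forall t : R, t \in `]- gs, gs[ -> `|t - c| < delta ->
      let rem N x := Phi t x - \sum_(n < N) ((t - c) ^+ n)%:C * a n x in
      (fun N => L2norm (rem N) + L2norm (A (rem N))) @ \oo --> (0 : R).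

End ScalarL2.

Section VectorL2.
Variable R : realType.
Implicit Types (u v w : cfun2 R) (D : set (cfun2 R)) (T P : cfun2 R -> cfun2 R).

Definition L2_2 v : Prop := L2 v.1 /\ L2 v.2.

Definition aeq2 u v : Prop := aeq u.1 v.1 /\ aeq u.2 v.2.

Definition add2 u v : cfun2 R :=
  (fun x => u.1 x + v.1 x, fun x => u.2 x + v.2 x).
Definition scale2 (c : R[i]) v : cfun2 R :=
  (fun x => c * v.1 x, fun x => c * v.2 x).
Definition zero2 : cfun2 R := (fun=> 0, fun=> 0).
Definition sigma3 v : cfun2 R := (v.1, fun x => - v.2 x).

Definition inner2 u v : R[i] := inner u.1 v.1 + inner u.2 v.2.

Definition L2norm2 v : R := Num.sqrt (complex.Re (inner2 v v)).

Definition lincomb m (c : 'I_m -> R[i]) (e : 'I_m -> cfun2 R) : cfun2 R :=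
  (fun x => \sum_(i < m) c i * (e i).1 x,
   fun x => \sum_(i < m) c i * (e i).2 x).

(* [S], a linear subspace up to a.e. equality, has dimension [m]. *)
Definition has_dim (S : set (cfun2 R)) (m : nat) : Prop :=
  exists e : 'I_m -> cfun2 R,
    [/\ forall i, S (e i),
        forall c, aeq2 (lincomb c e) zero2 -> forall i, c i = 0
      & forall v, S v -> exists c, aeq2 v (lincomb c e)].

(* [Rz] is the bounded inverse (z - T)^-1 of z - T, T having domain [D]. *)
Definition is_resolvent D T (z : R[i]) (Rz : cfun2 R -> cfun2 R) : Prop :=
  let zT v := add2 (scale2 z v) (scale2 (- 1) (T v)) in
  [/\ forall v, L2_2 v -> D (Rz v) /\ aeq2 (zT (Rz v)) v,
      forall v, D v -> aeq2 (Rz (zT v)) v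
    & exists C : R, forall v, L2_2 v -> L2norm2 (Rz v) <= C * L2norm2 v].

Definition resolvent_set D T : set R[i] :=
  [set z | exists Rz, is_resolvent D T z Rz].

Definition spectrum D T : set R[i] := ~` resolvent_set D T.

Definition isolated_in_spectrum D T (lam : R[i]) : Prop :=
  spectrum D T lam /\
  exists r : R, 0 < r /\
    forall z, z != lam -> `|z - lam| < r%:C -> resolvent_set D T z.

(* Integral over the positively oriented circle of center [c] and radius [r]. *)
Definition circle_integral (c : R[i]) (r : R) (F : R[i] -> R[i]) : R[i] :=
  cintegral `[0, 2 * pi] (fun t =>
    let e := cos t +i* sin t in F (c + r%:C * e) * ('i%C * r%:C * e)).

(* [P] is (2 i pi)^-1 times the contour integral of (z - T)^-1 over the circle
   |z - lam| = r, where [lam] is the only possible point of the spectrum in the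
   closed disk.  The operator-valued integral is the weak one, i.e. it is
   evaluated on matrix elements. *)
Definition riesz_projection D T (lam : R[i]) (r : R) P : Prop :=
  exists Res : R[i] -> cfun2 R -> cfun2 R,
    [/\ forall z, z != lam -> `|z - lam| <= r%:C -> is_resolvent D T z (Res z),
        forall v, L2_2 v -> L2_2 (P v)
      & forall v w, L2_2 v -> L2_2 w ->
          inner2 (P v) w =
          (2 * 'i%C * pi%:C)^-1 *
            circle_integral lam r (fun z => inner2 (Res z v) w)].

Definition algebraic_multiplicity D T (lam : R[i]) (m : nat) : Prop :=
  exists (r : R) P, [/\ 0 < r, riesz_projection D T lam r P
                      & has_dim (P @` [set v | L2_2 v]) m].

Definition geometric_multiplicity D T (lam : R[i]) (m : nat) : Prop :=
  has_dim [set v | D v /\ aeq2 (T v) (scale2 lam v)] m.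

Definition defective D T (lam : R[i]) : Prop :=
  exists m n : nat, [/\ geometric_multiplicity D T lam m,
    algebraic_multiplicity D T lam n & (m < n)%N].

End VectorL2.

Section LinearizedNLS.
Variable R : realType.
Variables (D0 : set (cfun R)) (L0 : cfun R -> cfun R).
Variables (W : R -> R) (g mu : R).

(* The stationary equation; [- d^2/dx^2 + V] acts on D(L0) as [L0]. *)
Definition stationary (gamma : R) (phi : cfun R) : Prop :=
  aeq (fun x => L0 phi x + 'i%C * gamma%:C * (W x)%:C * phi x
                - g%:C * `|phi x| ^+ 2 * phi x)
      (fun x => mu%:C * phi x).

Definition dom2 : set (cfun2 R) := [set v | D0 v.1 /\ D0 v.2].

Definition linearized (gamma : R) (phi : cfun R) (v : cfun2 R) : cfun2 R :=
  (fun x => L0 v.1 x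
     + ('i%C * gamma%:C * (W x)%:C - mu%:C - 2 * g%:C * `|phi x| ^+ 2) * v.1 x
     - g%:C * phi x ^+ 2 * v.2 x,
   fun x => - g%:C * conjc (phi x) ^+ 2 * v.1 x
     + (L0 v.2 x
        + (- 'i%C * gamma%:C * (W x)%:C - mu%:C - 2 * g%:C * `|phi x| ^+ 2)
          * v.2 x)).

Definition linearized_adj (gamma : R) (phi : cfun R) (v : cfun2 R) : cfun2 R :=
  (fun x => L0 v.1 x
     + (- 'i%C * gamma%:C * (W x)%:C - mu%:C - 2 * g%:C * `|phi x| ^+ 2) * v.1 x
     - g%:C * phi x ^+ 2 * v.2 x,
   fun x => - g%:C * conjc (phi x) ^+ 2 * v.1 x
     + (L0 v.2 x
        + ('i%C * gamma%:C * (W x)%:C - mu%:C - 2 * g%:C * `|phi x| ^+ 2)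
          * v.2 x)).

(* Spectral problem  L v = - i lam sigma3 v  for L on D(L0) x D(L0). *)
Definition spectral_eigenvalue (L : cfun2 R -> cfun2 R) (lam : R[i]) : Prop :=
  exists v, [/\ dom2 v, ~ aeq2 v (@zero2 R)
              & aeq2 (L v) (scale2 (- 'i%C * lam) (sigma3 v))].

Definition isigma3 (L : cfun2 R -> cfun2 R) (v : cfun2 R) : cfun2 R :=
  scale2 'i%C (sigma3 (L v)).

(* Isolatedness and multiplicities are those of the operator  i sigma3 L. *)
Definition isolated_defective_eigenvalue (L : cfun2 R -> cfun2 R) (lam : R[i])
    (geo alg : nat) : Prop :=
  [/\ spectral_eigenvalue L lam,
      isolated_in_spectrum dom2 (isigma3 L) lam,
      defective dom2 (isigma3 L) lam,
      geometric_multiplicity dom2 (isigma3 L) lam geo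
    & algebraic_multiplicity dom2 (isigma3 L) lam alg].

End LinearizedNLS.

Definition krein_quantity (R : realType) (v vs : cfun2 R) : R[i] :=
  inner2 v (sigma3 vs).

(* Main.v *)
(** Since L^* is the adjoint of L on D(L0) x D(L0), evaluating <L vg, v0s> and
    <L vg, vgs> in two ways gives the first two equalities.

    For the last claim let T = i sigma3 L, lam = i Omega0 and u = sigma3 v0s, an
    eigenvector of T^* for the conjugate of lam.  The resolvent of T acts
    explicitly on v0 and vg, so the Riesz projection P satisfies P v0 = v0 and
    P vg = vg + c v0 for some scalar c; as its range has dimension two, it is
    spanned by v0 and vg.  Likewise <P v, u> = <v, u> for every v.  If u were
    orthogonal to vg, then, being orthogonal to v0, it would be orthogonal to
    the range of P, hence <u, u> = <P u, u> = 0. *)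

Require Import Defs.
From mathcomp Require Import all_boot all_order all_algebra.
From mathcomp Require Import all_classical all_reals all_analysis.
From mathcomp Require Import measurable_realfun complex ring.

Set Implicit Arguments.
Unset Strict Implicit.
Unset Printing Implicit Defensive.

Import Order.TTheory GRing.Theory Num.Theory.
Import numFieldNormedType.Exports.

Local Open Scope classical_set_scope.
Local Open Scope ring_scope.
Local Open Scope complex_scope.

(** * Componentwise integration of complex-valued functions *)

Section ComplexIntegral.
Context {R : realType}.
Local Notation mu := (@lebesgue_measure R).

Lemma ae_eq_imply (A B : Type) (f h : R -> A) (f' h' : R -> B) :
  (forall x, f x = h x -> f' x = h' x) ->
  f = h %[ae mu] -> f' = h' %[ae mu].
Proof.
move=> ff'; apply: (@filterS _ _ (ae_filter_ringOfSetsType mu)) => x fh _.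
exact/ff'/fh.
Qed.

Lemma ae_eq_imply2 (A B C : Type) (f h : R -> A) (f' h' : R -> B)
    (f'' h'' : R -> C) :
  (forall x, f x = h x -> f' x = h' x -> f'' x = h'' x) ->
  f = h %[ae mu] -> f' = h' %[ae mu] -> f'' = h'' %[ae mu].
Proof.
move=> ff'; apply: (@filterS2 _ _ (ae_filter_ringOfSetsType mu)) => x fh fh' _.
by apply: ff'; [exact: fh|exact: fh'].
Qed.

Implicit Types (E : set R) (f h : cfun R).

Definition cintegrable E f : Prop :=
  mu.-integrable E (fun x => (complex.Re (f x))%:E) /\
  mu.-integrable E (fun x => (complex.Im (f x))%:E).

Lemma ReD (x y : R[i]) : complex.Re (x + y) = complex.Re x + complex.Re y.
Proof. by case: x; case: y. Qed.

Lemma ImD (x y : R[i]) : complex.Im (x + y) = complex.Im x + complex.Im y.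
Proof. by case: x; case: y. Qed.

Lemma ReM (x y : R[i]) : complex.Re (x * y) =
  complex.Re x * complex.Re y - complex.Im x * complex.Im y.
Proof. by case: x; case: y. Qed.

Lemma ImM (x y : R[i]) : complex.Im (x * y) =
  complex.Re x * complex.Im y + complex.Im x * complex.Re y.
Proof. by case: x; case: y. Qed.

Lemma ReMJ (x y : R[i]) : complex.Re (x * conjc y) =
  complex.Re x * complex.Re y + complex.Im x * complex.Im y.
Proof. by case: x y => a b [c d] /=; rewrite mulrN opprK. Qed.

Lemma ImMJ (x y : R[i]) : complex.Im (x * conjc y) =
  complex.Im x * complex.Re y - complex.Re x * complex.Im y.
Proof. by case: x y => a b [c d] /=; rewrite mulrN addrC. Qed.

Lemma cintegralD E f h : measurable (E : set (measurableTypeR R)) ->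
  cintegrable E f -> cintegrable E h ->
  cintegral E (fun x => f x + h x) = cintegral E f + cintegral E h.
Proof.
move=> mE [fr fi] [hr hi]; rewrite /cintegral.
under eq_Rintegral do rewrite ReD.
under [X in _ +i* X]eq_Rintegral do rewrite ImD.
by rewrite !RintegralD.
Qed.

Lemma cintegrableZ E (c : R[i]) f : measurable (E : set (measurableTypeR R)) ->
  cintegrable E f -> cintegrable E (fun x => c * f x).
Proof.
move=> mE [fr fi]; split.
  under eq_fun do rewrite ReM EFinB !EFinM.
  by apply: integrableB => //; exact: integrableZl.
under eq_fun do rewrite ImM EFinD !EFinM.
by apply: integrableD => //; exact: integrableZl.
Qed.

Lemma integrableZl_EFin E (k : R) (f : R -> R) :
  measurable (E : set (measurableTypeR R)) ->
  mu.-integrable E (fun x => (f x)%:E) ->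
  mu.-integrable E (fun x => (k * f x)%:E).
Proof. by move=> mE fE; under eq_fun do rewrite EFinM; exact: integrableZl. Qed.

Lemma cintegralZ E (c : R[i]) f : measurable (E : set (measurableTypeR R)) ->
  cintegrable E f -> cintegral E (fun x => c * f x) = c * cintegral E f.
Proof.
move=> mE [fr fi]; rewrite /cintegral.
under eq_Rintegral do rewrite ReM.
under [X in _ +i* X]eq_Rintegral do rewrite ImM.
rewrite RintegralB ?RintegralD//; try exact: integrableZl_EFin.
rewrite !RintegralZl//.
by case: c.
Qed.

Lemma cintegral_conj E f : measurable (E : set (measurableTypeR R)) ->
  cintegrable E f -> cintegral E (fun x => conjc (f x)) = conjc (cintegral E f).
Proof.
move=> mE [fr fi]; rewrite /cintegral /=; congr (_ +i* _).
  by apply: eq_Rintegral => x _; case: (f x).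
rewrite -mulN1r -RintegralZl//; apply: eq_Rintegral => x _.
by rewrite mulN1r; case: (f x).
Qed.

Lemma cintegral_aeq f h : cintegrable setT f -> cintegrable setT h ->
  aeq f h -> cintegral setT f = cintegral setT h.
Proof.
move=> [fr fi] [hr hi] fh; rewrite /cintegral /Rintegral.
congr (fine _ +i* fine _); apply: ae_eq_integral => //.
- exact: measurable_int fr.
- exact: measurable_int hr.
- by apply: ae_eq_imply fh => x /= ->.
- exact: measurable_int fi.
- exact: measurable_int hi.
- by apply: ae_eq_imply fh => x /= ->.
Qed.

End ComplexIntegral.

(** * Square-integrable functions, bounded multipliers and the scalar inner product *)

Section SquareIntegrable.
Context {R : realType}.
Local Notation mu := (@lebesgue_measure R).
Implicit Types (f h k : cfun R).

(** Replaces the finite 2-norm by integrability of the square, a form in which domination arguments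
    apply directly. *)
Lemma Lfun2P (f : measurableTypeR R -> R) : f \in Lfun mu 2%:E <->
  measurable_fun setT f /\ mu.-integrable setT (fun x => (f x ^+ 2)%:E).
Proof.
split=> [f2|[mf f2]].
  split; last exact: Lfun2_integrable_sqr.
  by have /sub_Lfun_mfun := f2; rewrite inE.
rewrite inE; apply/andP; split; first by rewrite inE.
rewrite inE /= /finite_norm unlock poweR_lty//.
case/integrableP: f2 => _; apply: le_lt_trans.
by under eq_integral => x _ do rewrite /= powR_mulrn// -normrX.
Qed.

Lemma Lfun2D (f h : measurableTypeR R -> R) : f \in Lfun mu 2%:E ->
  h \in Lfun mu 2%:E -> (fun x => f x + h x) \in Lfun mu 2%:E.
Proof. by move=> ff hh; apply: (rpredD ff hh); rewrite lee1n. Qed.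

Lemma Lfun2B (f h : measurableTypeR R -> R) : f \in Lfun mu 2%:E ->
  h \in Lfun mu 2%:E -> (fun x => f x - h x) \in Lfun mu 2%:E.
Proof. by move=> ff hh; apply: (rpredB ff hh); rewrite lee1n. Qed.

Lemma Lfun2M_bounded (a f : measurableTypeR R -> R) (M : R) :
  measurable_fun setT a -> (forall x, `|a x| <= M) ->
  f \in Lfun mu 2%:E -> (fun x => a x * f x) \in Lfun mu 2%:E.
Proof.
move=> ma aM /Lfun2P[mf f2]; apply/Lfun2P.
have maf : measurable_fun setT (fun x => a x * f x) by exact: measurable_funM.
split=> //.
apply: (le_integrable _ _ _ (integrableZl measurableT (M ^+ 2) f2)) => //=.
  by apply/measurable_EFinP; exact: measurable_funX.
move=> x _; rewrite lee_fin -exprMn !normrX lerXn2r ?nnegrE// !normrM.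
by rewrite ler_wpM2r// (le_trans (aM x))// ler_norm.
Qed.

(** The multipliers allowed as matrix entries of the linearized operator. Real and imaginary parts
    are treated separately, with a common bound, to match the componentwise definition of [L2]. *)
Record bounded_mfun (a : cfun R) : Prop := BoundedMfun {
  bounded_mfun_Re :
    measurable_fun setT (fun x : measurableTypeR R => complex.Re (a x));
  bounded_mfun_Im :
    measurable_fun setT (fun x : measurableTypeR R => complex.Im (a x));
  bounded_mfun_bound : exists M : R, forall x,
    `|complex.Re (a x)| <= M /\ `|complex.Im (a x)| <= M }.

Lemma bounded_mfun_cst (c : R[i]) : bounded_mfun (fun=> c).
Proof.
split=> //; exists (`|complex.Re c| + `|complex.Im c|) => x.
by rewrite lerDl lerDr.
Qed.

Lemma bounded_mfun_real (a : R -> R) (M : R) :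
  measurable_fun [set: R] a -> (forall x, `|a x| <= M) ->
  bounded_mfun (fun x => (a x)%:C).
Proof.
move=> ma aM; split=> //; exists M => x /=; split=> //.
by rewrite normr0 (le_trans _ (aM x)).
Qed.

Lemma bounded_mfunD (a b : cfun R) : bounded_mfun a -> bounded_mfun b ->
  bounded_mfun (fun x => a x + b x).
Proof.
move=> [ar ai [M aM]] [br bi [N bN]]; split.
- by under eq_fun do rewrite ReD; exact: measurable_funD.
- by under eq_fun do rewrite ImD; exact: measurable_funD.
- exists (M + N) => x; have [? ?] := aM x; have [? ?] := bN x.
  by rewrite ReD ImD; split; apply: (le_trans (ler_normD _ _)); exact: lerD.
Qed.

Lemma bounded_mfunM (a b : cfun R) : bounded_mfun a -> bounded_mfun b ->
  bounded_mfun (fun x => a x * b x).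
Proof.
move=> [ar ai [M aM]] [br bi [N bN]]; split.
- under eq_fun do rewrite ReM.
  by apply: measurable_funB; exact: measurable_funM.
- under eq_fun do rewrite ImM.
  by apply: measurable_funD; exact: measurable_funM.
- exists (M * N + M * N) => x; have [? ?] := aM x; have [? ?] := bN x.
  rewrite ReM ImM; split.
    by apply: (le_trans (ler_normB _ _)); rewrite !normrM lerD// ler_pM.
  by apply: (le_trans (ler_normD _ _)); rewrite !normrM lerD// ler_pM.
Qed.

Lemma bounded_mfun_conj (a : cfun R) : bounded_mfun a ->
  bounded_mfun (fun x => conjc (a x)).
Proof.
have rJ (z : R[i]) : complex.Re (conjc z) = complex.Re z by case: z.
have iJ (z : R[i]) : complex.Im (conjc z) = - complex.Im z by case: z.
move=> [ar ai [M aM]]; split.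
- by under eq_fun do rewrite rJ.
- by under eq_fun do rewrite iJ; exact: measurableT_comp.
- by exists M => x; rewrite rJ iJ normrN; exact: aM.
Qed.

Lemma L2D f h : L2 f -> L2 h -> L2 (fun x => f x + h x).
Proof.
move=> [fr fi] [hr hi]; split.
- by under eq_fun do rewrite ReD; exact: Lfun2D.
- by under eq_fun do rewrite ImD; exact: Lfun2D.
Qed.

Lemma L2M a f : bounded_mfun a -> L2 f -> L2 (fun x => a x * f x).
Proof.
move=> [ar ai [M aM]] [fr fi].
have [arM aiM] := all_and2 aM.
split.
- under eq_fun do rewrite ReM.
  by apply: Lfun2B; exact: (@Lfun2M_bounded _ _ M).
- under eq_fun do rewrite ImM.
  by apply: Lfun2D; exact: (@Lfun2M_bounded _ _ M).
Qed.

Lemma L2Z (c : R[i]) f : L2 f -> L2 (fun x => c * f x).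
Proof. by apply: L2M; exact: bounded_mfun_cst. Qed.

Lemma L2_zero : L2 (fun=> 0 : R[i]).
Proof.
have Z : (fun=> 0 : R) \in Lfun mu 2%:E.
  apply/Lfun2P; split=> //; under eq_fun do rewrite expr0n.
  exact: integrable0.
by split.
Qed.

(** The real and imaginary parts of the integrand are a sum and a difference of products of two
    square-integrable real functions, and such products are integrable by the Cauchy-Schwarz
    inequality. *)
Lemma cintegrable_inner f h : L2 f -> L2 h ->
  cintegrable setT (fun x => f x * conjc (h x)).
Proof.
have M (a b : measurableTypeR R -> R) : a \in Lfun mu 2%:E ->
    b \in Lfun mu 2%:E -> mu.-integrable setT (fun x => (a x * b x)%:E).
  by move=> a2 b2; have /Lfun1_integrable := Lfun2_mul_Lfun1 a2 b2.
move=> [fr fi] [hr hi]; split.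
- by under eq_fun do rewrite ReMJ EFinD; apply: integrableD => //; exact: M.
- by under eq_fun do rewrite ImMJ EFinB; apply: integrableB => //; exact: M.
Qed.

Lemma innerDl f h k : L2 f -> L2 h -> L2 k ->
  inner (fun x => f x + h x) k = inner f k + inner h k.
Proof.
move=> f2 h2 k2; rewrite /inner -cintegralD//; [|exact: cintegrable_inner..].
by congr cintegral; apply/funext => x; rewrite mulrDl.
Qed.

Lemma innerZl (c : R[i]) f k : L2 f -> L2 k ->
  inner (fun x => c * f x) k = c * inner f k.
Proof.
move=> f2 k2; rewrite /inner -cintegralZ//; last exact: cintegrable_inner.
by congr cintegral; apply/funext => x; rewrite mulrA.
Qed.

Lemma inner_conj f h : L2 f -> L2 h -> inner f h = conjc (inner h f).
Proof.
move=> f2 h2; rewrite /inner -cintegral_conj//; last exact: cintegrable_inner.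
by congr cintegral; apply/funext => x; rewrite rmorphM /= conjcK mulrC.
Qed.

Lemma inner_aeql f h k : L2 f -> L2 h -> L2 k -> aeq f h ->
  inner f k = inner h k.
Proof.
move=> f2 h2 k2 fh; apply: cintegral_aeq; [exact: cintegrable_inner..|].
by apply: ae_eq_imply fh => x ->.
Qed.

(** The two integrands agree pointwise: the adjoint of a multiplication operator is multiplication
    by the conjugate. *)
Lemma innerMl (a : cfun R) f k :
  inner (fun x => a x * f x) k = inner f (fun x => conjc (a x) * k x).
Proof.
rewrite /inner; congr cintegral; apply/funext => x.
by rewrite rmorphM /= conjcK mulrCA mulrA.
Qed.

Lemma inner_self_ge0 f : 0 <= complex.Re (inner f f).
Proof.
apply: Rintegral_ge0 => x _; rewrite ReMJ.
by rewrite addr_ge0// -expr2 sqr_ge0.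
Qed.

(** The integrand is a sum of two squares; being nonnegative with zero integral it vanishes a.e.,
    and then so do both squares. *)
Lemma inner_self_eq0 f : L2 f -> complex.Re (inner f f) = 0 ->
  aeq f (fun=> 0).
Proof.
move=> f2; have [fi _] := cintegrable_inner f2 f2.
rewrite /inner /cintegral /= /Rintegral => /eqP.
rewrite fine_eq0; last exact: integrable_fin_num.
move=> /eqP f0.
have : (\int[mu]_x `|(complex.Re (f x * conjc (f x)))%:E| = 0)%E.
  rewrite -[RHS]f0; apply: eq_integral => x _.
  by rewrite gee0_abs// lee_fin ReMJ addr_ge0// -expr2 sqr_ge0.
move=> int0.
have := (ae_eq_integral_abs mu measurableT (measurable_int _ fi)).1 int0.
apply: ae_eq_imply => x; rewrite ReMJ -!expr2 => -[/eqP].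
rewrite paddr_eq0 ?sqr_ge0// !sqrf_eq0 => /andP[/eqP r0 /eqP i0].
by move: r0 i0; case: (f x) => a b /= -> ->.
Qed.

End SquareIntegrable.

(** * The inner product on pairs of functions and finite-dimensional ranges *)

Section VectorInner.
Context {R : realType}.
Implicit Types (u v w : cfun2 R) (c : R[i]).

Lemma cfun2_eq u v : (forall x, u.1 x = v.1 x) -> (forall x, u.2 x = v.2 x) ->
  u = v.
Proof. by case: u v => [a b] [c d] /= /funext -> /funext ->. Qed.

Lemma aeq2_refl u : aeq2 u u.
Proof. by split; exact: aeW. Qed.

Lemma aeq2_sym u v : aeq2 u v -> aeq2 v u.
Proof.
by move=> [uv1 uv2]; split; [move: uv1|move: uv2]; exact: ae_eq_imply.
Qed.

Lemma aeq2_trans v u w : aeq2 u v -> aeq2 v w -> aeq2 u w.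
Proof.
move=> [uv1 uv2] [vw1 vw2].
by split; [apply: ae_eq_imply2 uv1 vw1|apply: ae_eq_imply2 uv2 vw2] => x -> ->.
Qed.

Lemma aeq2D u u' v v' : aeq2 u u' -> aeq2 v v' ->
  aeq2 (add2 u v) (add2 u' v').
Proof.
move=> [uv1 uv2] [vw1 vw2].
by split; [apply: ae_eq_imply2 uv1 vw1|apply: ae_eq_imply2 uv2 vw2]
  => x /= -> ->.
Qed.

Lemma aeq2Z c u u' : aeq2 u u' -> aeq2 (scale2 c u) (scale2 c u').
Proof.
by move=> [u1 u2]; split; [apply: ae_eq_imply u1|apply: ae_eq_imply u2]
  => x /= ->.
Qed.

Lemma aeq2_sigma3 u u' : aeq2 u u' -> aeq2 (sigma3 u) (sigma3 u').
Proof. by move=> [u1 u2]; split=> //; apply: ae_eq_imply u2 => x /= ->. Qed.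

Lemma aeq2_scale_eq0 c u : aeq2 (scale2 c u) (zero2 R) ->
  ~ aeq2 u (zero2 R) -> c = 0.
Proof.
move=> cu0 u_neq0; apply: contrapT => /eqP c0; apply: u_neq0.
have -> : u = scale2 c^-1 (scale2 c u).
  by apply: cfun2_eq => x /=; rewrite mulKf.
have -> : zero2 R = scale2 c^-1 (zero2 R).
  by apply: cfun2_eq => x /=; rewrite mulr0.
exact: aeq2Z.
Qed.

Lemma L2_2_add2 u v : L2_2 u -> L2_2 v -> L2_2 (add2 u v).
Proof. by move=> [? ?] [? ?]; split; exact: L2D. Qed.

Lemma L2_2_scale2 c u : L2_2 u -> L2_2 (scale2 c u).
Proof. by move=> [? ?]; split; exact: L2Z. Qed.

(** Turns the negation into multiplication by a constant, so that [L2Z] and [innerMl] apply. *)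
Lemma sigma3E u : sigma3 u = (u.1, fun x => -1 * u.2 x).
Proof. by congr pair; apply/funext => x; rewrite mulN1r. Qed.

Lemma L2_2_sigma3 u : L2_2 u -> L2_2 (sigma3 u).
Proof. by rewrite sigma3E => -[? ?]; split => //; exact: L2Z. Qed.

Lemma sigma3K u : sigma3 (sigma3 u) = u.
Proof. by apply: cfun2_eq => x //=; rewrite opprK. Qed.

Lemma inner2Dl u v w : L2_2 u -> L2_2 v -> L2_2 w ->
  inner2 (add2 u v) w = inner2 u w + inner2 v w.
Proof. by move=> [? ?] [? ?] [? ?]; rewrite /inner2 !innerDl// addrACA. Qed.

Lemma inner2Zl c u w : L2_2 u -> L2_2 w ->
  inner2 (scale2 c u) w = c * inner2 u w.
Proof. by move=> [? ?] [? ?]; rewrite /inner2 !innerZl// mulrDr. Qed.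

Lemma inner2_conj u v : L2_2 u -> L2_2 v -> inner2 u v = conjc (inner2 v u).
Proof.
move=> [? ?] [? ?].
by rewrite /inner2 (@inner_conj _ u.1)// (@inner_conj _ u.2)// rmorphD.
Qed.

Lemma inner2Dr u v w : L2_2 u -> L2_2 v -> L2_2 w ->
  inner2 w (add2 u v) = inner2 w u + inner2 w v.
Proof.
move=> u2 v2 w2; have uv2 := L2_2_add2 u2 v2.
rewrite inner2_conj// inner2Dl// rmorphD.
by congr (_ + _); exact/esym/inner2_conj.
Qed.

Lemma inner2Zr c u w : L2_2 u -> L2_2 w ->
  inner2 w (scale2 c u) = conjc c * inner2 w u.
Proof.
move=> u2 w2; have cu2 := L2_2_scale2 c u2.
rewrite inner2_conj// inner2Zl// rmorphM.
by congr (_ * _); exact/esym/inner2_conj.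
Qed.

Lemma inner2_aeql u v w : L2_2 u -> L2_2 v -> L2_2 w -> aeq2 u v ->
  inner2 u w = inner2 v w.
Proof.
move=> [? ?] [? ?] [? ?] [uv1 uv2].
by rewrite /inner2 (inner_aeql _ _ _ uv1)// (inner_aeql _ _ _ uv2).
Qed.

Lemma inner2_aeqr u v w : L2_2 u -> L2_2 v -> L2_2 w -> aeq2 u v ->
  inner2 w u = inner2 w v.
Proof.
move=> u2 v2 w2 uv.
by rewrite inner2_conj// (inner2_aeql u2 v2)// -inner2_conj.
Qed.

Lemma inner2_sigma3 u v : inner2 (sigma3 u) v = inner2 u (sigma3 v).
Proof.
rewrite !sigma3E /inner2 /= innerMl; congr (_ + inner _ _).
by apply/funext => x; rewrite rmorphN1.
Qed.

Lemma inner2_self_ge0 u : 0 <= complex.Re (inner2 u u).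
Proof. by rewrite /inner2 ReD addr_ge0 ?inner_self_ge0. Qed.

Lemma inner2_self_eq0 u : L2_2 u -> complex.Re (inner2 u u) = 0 ->
  aeq2 u (zero2 R).
Proof.
move=> [u1 u2] /eqP; rewrite /inner2 ReD paddr_eq0 ?inner_self_ge0//.
by move=> /andP[/eqP ? /eqP ?]; split; exact: inner_self_eq0.
Qed.

Lemma L2norm2_eq0 u : L2_2 u -> L2norm2 u = 0 -> aeq2 u (zero2 R).
Proof.
move=> u2 /eqP; rewrite /L2norm2 sqrtr_eq0 => u_le0.
apply: inner2_self_eq0 => //; apply/eqP.
by rewrite eq_le u_le0 inner2_self_ge0.
Qed.

Lemma L2_2_zero2 : L2_2 (zero2 R).
Proof. by split; exact: L2_zero. Qed.

Lemma inner2_zero2l w : L2_2 w -> inner2 (zero2 R) w = 0.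
Proof.
move=> w2; have -> : zero2 R = scale2 0 (zero2 R).
  by apply: cfun2_eq => x /=; rewrite mul0r.
by rewrite inner2Zl ?mul0r//; exact: L2_2_zero2.
Qed.

Lemma L2norm2_aeq0 u : L2_2 u -> aeq2 u (zero2 R) -> L2norm2 u = 0.
Proof.
move=> u2 u0; rewrite /L2norm2 (inner2_aeql u2 L2_2_zero2 u2 u0).
by rewrite inner2_zero2l// sqrtr0.
Qed.

(** Testing against [w = u - v] gives a difference of zero norm. A Riesz projection is specified by
    its matrix elements alone, and this recovers its values from them. *)
Lemma inner2_ext u v : L2_2 u -> L2_2 v ->
  (forall w, L2_2 w -> inner2 u w = inner2 v w) -> aeq2 u v.
Proof.
move=> u2 v2 uv; pose d := add2 u (scale2 (-1) v).
have Nv2 := L2_2_scale2 (-1) v2.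
have d2 : L2_2 d by exact: L2_2_add2.
have d0 : aeq2 d (zero2 R).
  apply: inner2_self_eq0 => //.
  by rewrite {1}/d inner2Dl// inner2Zl// uv// mulN1r subrr.
have -> : u = add2 d v by apply: cfun2_eq => x /=; rewrite mulN1r subrK.
have {2}-> : v = add2 (zero2 R) v by apply: cfun2_eq => x /=; rewrite add0r.
by apply: aeq2D => //; exact: aeq2_refl.
Qed.

Lemma lincombS m (c : 'I_m.+1 -> R[i]) (e : 'I_m.+1 -> cfun2 R) :
  lincomb c e = add2 (scale2 (c ord0) (e ord0))
    (lincomb (c \o lift ord0) (e \o lift ord0)).
Proof. by apply: cfun2_eq => x /=; rewrite big_ord_recl. Qed.

Lemma lincomb0 (c : 'I_0 -> R[i]) (e : 'I_0 -> cfun2 R) :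
  lincomb c e = zero2 R.
Proof. by apply: cfun2_eq => x /=; rewrite big_ord0. Qed.

Lemma L2_2_lincomb m (c : 'I_m -> R[i]) (e : 'I_m -> cfun2 R) :
  (forall i, L2_2 (e i)) -> L2_2 (lincomb c e).
Proof.
elim: m c e => [|m IH] c e e2; first by rewrite lincomb0; exact: L2_2_zero2.
rewrite lincombS; apply: L2_2_add2; first exact: L2_2_scale2.
by apply: IH => i; exact: e2.
Qed.

Lemma inner2_lincombl m (c : 'I_m -> R[i]) (e : 'I_m -> cfun2 R) w :
  (forall i, L2_2 (e i)) -> L2_2 w ->
  inner2 (lincomb c e) w = \sum_i c i * inner2 (e i) w.
Proof.
move=> + w2; elim: m c e => [|m IH] c e e2.
  by rewrite lincomb0 big_ord0 inner2_zero2l.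
rewrite lincombS inner2Dl//; last by apply: L2_2_lincomb => i; exact: e2.
  rewrite inner2Zl// big_ord_recl IH// => i; exact: e2.
exact: L2_2_scale2.
Qed.

Lemma aeq2_lincomb m (c : 'I_m -> R[i]) (e e' : 'I_m -> cfun2 R) :
  (forall i, aeq2 (e i) (e' i)) -> aeq2 (lincomb c e) (lincomb c e').
Proof.
elim: m c e e' => [|m IH] c e e' ee'.
  by rewrite !lincomb0; exact: aeq2_refl.
rewrite !lincombS; apply: aeq2D; first exact: aeq2Z.
by apply: IH => i; exact: ee'.
Qed.

(** As many independent elements as the dimension form a basis: the matrix [A] expressing [f] in the
    spanning family [e] is invertible, so [u] is orthogonal to [e] as soon as it is orthogonal to
    [f]. *)
Lemma has_dim_annihilator m (S : set (cfun2 R)) (f : 'I_m -> cfun2 R) u :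
  has_dim S m -> S `<=` @L2_2 R -> (forall i, S (f i)) ->
  (forall c : 'I_m -> R[i],
     aeq2 (lincomb c f) (zero2 R) -> forall i, c i = 0) ->
  L2_2 u -> (forall i, inner2 (f i) u = 0) ->
  forall v, S v -> inner2 v u = 0.
Proof.
move=> [e [Se _ span_e]] S2 Sf free_f u2 fu0.
have e2 i := S2 _ (Se i).
have inner_span v (c : 'I_m -> R[i]) : L2_2 v -> aeq2 v (lincomb c e) ->
    inner2 v u = \sum_i c i * inner2 (e i) u.
  move=> v2 vc; rewrite -inner2_lincombl//.
  by apply: inner2_aeql => //; exact: L2_2_lincomb.
have /choice[C fC] :
    forall i, exists c : 'I_m -> R[i], aeq2 (f i) (lincomb c e).
  by move=> i; exact: span_e.
pose A : 'M[R[i]]_m := \matrix_(i, j) C i j.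
have A_unit : A \in unitmx.
  (* A row [x] killed by [A] is the coefficient vector of a combination of the [f i] that vanishes
     a.e., hence is zero by independence. *)
  rewrite -row_free_unit; apply: inj_row_free => x xA0.
  apply/rowP => i; rewrite mxE; apply: (free_f (x 0)).
  apply: (aeq2_trans (aeq2_lincomb (x 0) fC)).
  have xAj j : \sum_i x 0 i * C i j = 0.
    have /rowP/(_ j) := xA0; rewrite !mxE => xA0j; rewrite -[RHS]xA0j.
    by apply: eq_bigr => k _; rewrite mxE.
  have swap (E : 'I_m -> R[i]) :
      \sum_i x 0 i * \sum_j C i j * E j = 0.
    under eq_bigr do rewrite mulr_sumr.
    rewrite exchange_big big1// => j _.
    by under eq_bigr do rewrite mulrA; rewrite -mulr_suml xAj mul0r.
  have -> : lincomb (x 0) (fun i => lincomb (C i) e) = zero2 R.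
    by apply: cfun2_eq => y /=; exact: swap.
  exact: aeq2_refl.
(* [A *m E] is the column of the products [inner2 (f i) u], all zero. *)
pose E : 'cV[R[i]]_m := \col_j inner2 (e j) u.
have E0 : E = 0.
  rewrite -[E](mulKmx A_unit) (_ : A *m E = 0) ?mulmx0//.
  apply/colP => i; rewrite !mxE -[RHS](fu0 i).
  rewrite (inner_span _ _ (S2 _ (Sf i)) (fC i)).
  by apply: eq_bigr => j _; rewrite !mxE.
move=> v Sv; have [c vc] := span_e v Sv.
rewrite (inner_span _ _ (S2 _ Sv) vc) big1// => j _.
by have /colP/(_ j) := E0; rewrite !mxE => ->; rewrite mulr0.
Qed.

End VectorInner.

(** * Resolvent and Riesz projection on a Jordan chain *)

Section RieszRange.
Context {R : realType}.
Implicit Types (u v w : cfun2 R) (c : R[i]).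

(* The integral on the right-hand side vanishes, but its value is irrelevant:
   it only shifts P vg by a multiple of v0. *)
Lemma circle_integral_pole (lam : R[i]) (r : R) (F : R[i] -> R[i])
    (a b : R[i]) :
  0 < r ->
  (forall z, z != lam -> `|z - lam| <= r%:C ->
    F z = (z - lam)^-1 * a + (z - lam) ^- 2 * b) ->
  (2 * 'i%C * pi%:C)^-1 * circle_integral lam r F =
  a + b *
    ((2 * 'i%C * pi%:C)^-1 * circle_integral lam r (fun z => (z - lam) ^- 2)).
Proof.
move=> r_gt0 F_pole.
have mE : measurable (`[0, 2 * pi] : set (measurableTypeR R)) by [].
pose e (t : R) : R[i] := cos t +i* sin t.
have e_unit t : e t * conjc (e t) = 1.
  rewrite /e; apply/eqP; rewrite eq_complex /= mulrN opprK -!expr2.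
  by rewrite cos2Dsin2 eqxx /= mulrN mulrC addNr.
have e_neq0 t : e t != 0.
  by apply/negP => /eqP e0; have := e_unit t; rewrite e0 mul0r => /eqP;
    rewrite eq_sym oner_eq0.
have r_neq0 : r%:C != 0 :> R[i] by rewrite fmorph_eq0 gt_eqF.
have norm_e t : `|e t| = 1.
  by rewrite normc_def /= cos2Dsin2 sqrtr1.
have on_circle t : F (lam + r%:C * e t) =
    (r%:C * e t)^-1 * a + (r%:C * e t) ^- 2 * b.
  have shift : lam + r%:C * e t - lam = r%:C * e t by rewrite addrC addKr.
  have re_neq0 : lam + r%:C * e t != lam.
    by rewrite -subr_eq0 shift mulf_neq0.
  rewrite F_pole// shift//.
  by rewrite normrM norm_e mulr1 ger0_norm// ler0c ltW.
(* The double pole times the speed of the parametrization. It equals ['i / r] times the conjugate of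
   [e t], a combination of cosine and sine, hence is integrable. *)
pose G t : R[i] := (r%:C * e t) ^- 2 * ('i%C * r%:C * e t).
have G_int : cintegrable `[0, 2 * pi] G.
  have -> : G = fun t => ('i%C / r%:C) * conjc (e t).
    apply/funext => t; rewrite /G.
    have -> : conjc (e t) = (e t)^-1.
      by apply: (mulfI (e_neq0 t)); rewrite e_unit divff.
    by field; rewrite r_neq0 e_neq0.
  apply: cintegrableZ => //; split.
    apply: continuous_compact_integrable; first exact: segment_compact.
    by apply: continuous_subspaceT => x; exact: continuous_cos.
  apply: continuous_compact_integrable; first exact: segment_compact.
  apply: continuous_subspaceT => x; apply: cvgN; exact: continuous_sin.
have cst_int : cintegrable `[0, 2 * pi] (fun=> 'i%C * a).
  split; apply: continuous_compact_integrable; first exact: segment_compact.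
  - by apply: continuous_subspaceT => x; exact: cst_continuous.
  - exact: segment_compact.
  - by apply: continuous_subspaceT => x; exact: cst_continuous.
rewrite /circle_integral.
(* On the circle [dz = i (z - lam) dt], so the simple pole contributes the constant ['i * a]; its
   integral over a full turn cancels the prefactor. *)
have -> : cintegral `[0, 2 * pi] (fun t =>
    let e := cos t +i* sin t in F (lam + r%:C * e) * ('i%C * r%:C * e)) =
  cintegral `[0, 2 * pi] (fun t => 'i%C * a + b * G t).
  congr cintegral; apply/funext => t.
  rewrite /= -/(e t) on_circle /G; field.
  by rewrite r_neq0 e_neq0.
rewrite cintegralD//; last exact: cintegrableZ.
rewrite (@cintegralZ _ _ b)// mulrDr; congr (_ + _).
  have pi2_gt0 : 0 < 2 * pi :> R by rewrite mulr_gt0 ?pi_gt0.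
  have -> : cintegral `[0, 2 * pi] (fun=> 'i%C * a) = (2 * pi)%:C * ('i%C * a).
    have itvE : fine (@lebesgue_measure R `[0, 2 * pi]) = 2 * pi.
      by rewrite lebesgue_measure_itv /= lte_fin pi2_gt0 -EFinD /= oppr0 addr0.
    rewrite /cintegral (Rintegral_cst _ mE) (Rintegral_cst _ mE) itvE.
    case: ('i%C * a) => x y; apply/eqP; rewrite eq_complex /=.
    by rewrite !mul0r subr0 addr0 ![_ * (2 * pi)]mulrC !eqxx.
  have pi_neq0 : pi%:C != 0 :> R[i] by rewrite fmorph_eq0 gt_eqF ?pi_gt0.
  have i_neq0 : 'i%C != 0 :> R[i] by rewrite eq_complex /= oner_eq0 andbF.
  have -> : (2 * pi)%:C = 2 * pi%:C :> R[i] by rewrite rmorphM rmorph_nat.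
  (* Generalizing both constants makes them atoms for [field]. *)
  move: (pi%:C) ('i%C : R[i]) pi_neq0 i_neq0 => p i p_neq0 i_neq0.
  by field; rewrite p_neq0 i_neq0.
rewrite mulrCA; congr (_ * (_ * _)); congr cintegral.
apply/funext => t; rewrite /= -/(e t) /G.
by rewrite [lam + _]addrC addrK.
Qed.


(** Linearity for operators on representatives. By the third clause, applied to differences, the
    second one means that [T] respects a.e. equality on [D]. *)
Definition linear_operator2 (D : set (cfun2 R)) (T : cfun2 R -> cfun2 R) :
    Prop :=
  [/\ forall v, D v -> L2_2 v /\ L2_2 (T v),
      forall v, D v -> aeq2 v (zero2 R) -> aeq2 (T v) (zero2 R)
    & forall c u v, D u -> D v -> D (add2 (scale2 c u) v) /\
        aeq2 (T (add2 (scale2 c u) v)) (add2 (scale2 c (T u)) (T v))].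

Variables (D : set (cfun2 R)) (T : cfun2 R -> cfun2 R).
Hypothesis linT : linear_operator2 D T.

Lemma linear_operator2_comb a b u v : D u -> D v ->
  D (add2 (scale2 a u) (scale2 b v)) /\
  aeq2 (T (add2 (scale2 a u) (scale2 b v)))
       (add2 (scale2 a (T u)) (scale2 b (T v))).
Proof.
case: linT => _ _ linD Du Dv.
(* [linear_operator2] speaks only of combinations [c u + v]; a bare multiple is obtained from it by
   splitting off one copy of [w]. *)
have scaleE c w : scale2 c w = add2 (scale2 (c - 1) w) w.
  by apply: cfun2_eq => x /=; rewrite mulrBl mul1r subrK.
have [Dbv Tbv] := linD (b - 1) v v Dv Dv.
rewrite -!scaleE in Dbv Tbv.
have [? Tab] := linD a u _ Du Dbv; split=> //.
by apply: aeq2_trans Tab _; apply: aeq2D => //; exact: aeq2_refl.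
Qed.

Let shifted z v := add2 (scale2 z v) (scale2 (- 1) (T v)).

(** The difference [d = Rz v - w] is sent to zero a.e. by [z - T]. The norm bound on [Rz] makes
    [Rz ((z - T) d)] zero a.e., although [is_resolvent] does not state compatibility with a.e.
    equality, and the left inverse property then gives [d = 0] a.e. *)
Lemma resolvent_uniq z Rz v w : is_resolvent D T z Rz -> L2_2 v -> D w ->
  aeq2 (shifted z w) v -> aeq2 (Rz v) w.
Proof.
case: linT => DL2 _ _ [RzD Rz_left [C RzC]] v2 Dw wv.
have [Da av] := RzD v v2; rewrite -/(shifted z (Rz v)) in av.
set a := Rz v in Da av *.
have [Dd Td] := linear_operator2_comb 1 (-1) Da Dw.
set d := add2 _ _ in Dd Td.
have zd0 : aeq2 (shifted z d) (zero2 R).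
  have -> : zero2 R = add2 v (scale2 (-1) v).
    by apply: cfun2_eq => x /=; rewrite mulN1r subrr.
  apply: (aeq2_trans _ (aeq2D av (aeq2Z (-1) wv))).
  apply: (aeq2_trans (aeq2D (aeq2_refl _) (aeq2Z (-1) Td))).
  suff -> : add2 (shifted z a) (scale2 (-1) (shifted z w)) =
    add2 (scale2 z d) (scale2 (-1) (add2 (scale2 1 (T a)) (scale2 (-1) (T w)))).
    exact: aeq2_refl.
  by apply: cfun2_eq => x /=; ring.
have zd2 : L2_2 (shifted z d).
  by have [? ?] := DL2 _ Dd; apply: L2_2_add2; exact: L2_2_scale2.
have [DRd _] := RzD _ zd2; have [Rd2 _] := DL2 _ DRd.
have Rd0 : aeq2 (Rz (shifted z d)) (zero2 R).
  apply: L2norm2_eq0 => //; apply/eqP; rewrite eq_le sqrtr_ge0 andbT.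
  by have := RzC _ zd2; rewrite [L2norm2 (shifted _ _)]L2norm2_aeq0// mulr0.
have d0 := aeq2_trans (aeq2_sym (Rz_left _ Dd)) Rd0.
have -> : a = add2 d w by apply: cfun2_eq => x /=; ring.
have {2}-> : w = add2 (zero2 R) w by apply: cfun2_eq => x /=; rewrite add0r.
by apply: aeq2D => //; exact: aeq2_refl.
Qed.

Variables (lam k : R[i]) (v0 vg u : cfun2 R).
Hypotheses (Dv0 : D v0) (Dvg : D vg) (u2 : L2_2 u).
Hypothesis Tv0 : aeq2 (T v0) (scale2 lam v0).
Hypothesis u_adj : forall v, D v -> inner2 (T v) u = lam * inner2 v u.

(** The right-hand side is the solution of [(z - T) y = w] sought in the span of [w] and [v0]. The
    case [l = 0] covers [v0], and [l = k] covers [vg]. *)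
Lemma resolvent_generalized_eigenvector z Rz l w : is_resolvent D T z Rz ->
  z != lam -> D w -> aeq2 (T w) (add2 (scale2 lam w) (scale2 l v0)) ->
  aeq2 (Rz w) (add2 (scale2 (z - lam)^-1 w) (scale2 ((z - lam) ^- 2 * l) v0)).
Proof.
move=> Rzz zlam Dw Tw; have s_neq0 : z - lam != 0 by rewrite subr_eq0.
case: (linT) => DL2 _ _.
have [Dy Ty] := linear_operator2_comb (z - lam)^-1 ((z - lam) ^- 2 * l) Dw Dv0.
apply: (resolvent_uniq Rzz) => //; first exact: (DL2 _ Dw).1.
have Ty' := aeq2_trans Ty (aeq2D (aeq2Z _ Tw) (aeq2Z _ Tv0)).
apply: (aeq2_trans (aeq2D (aeq2_refl _) (aeq2Z (-1) Ty'))).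
rewrite (_ : add2 _ _ = w); first exact: aeq2_refl.
by apply: cfun2_eq => x /=; field.
Qed.

(** By the explicit resolvent, each matrix element has a simple pole with coefficient [inner2 w y]
    and a double pole with coefficient [l * inner2 v0 y]. *)
Lemma inner_riesz_generalized r P l w y : 0 < r ->
  riesz_projection D T lam r P -> D w ->
  aeq2 (T w) (add2 (scale2 lam w) (scale2 l v0)) -> L2_2 y ->
  inner2 (P w) y = inner2 w y + l * inner2 v0 y *
    ((2 * 'i%C * pi%:C)^-1 * circle_integral lam r (fun z => (z - lam) ^- 2)).
Proof.
move=> r_gt0 [Res [Res_resolvent _ PE]] Dw Tw y2.
case: (linT) => DL2 _ _.
have [w2 _] := DL2 _ Dw; have [v02 _] := DL2 _ Dv0.
rewrite PE//; apply: circle_integral_pole => // z zlam zr.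
have Rz := Res_resolvent _ zlam zr.
have Rzw := resolvent_generalized_eigenvector Rz zlam Dw Tw.
have [RzD _ _] := Rz; have [DRz _] := RzD _ w2.
rewrite (inner2_aeql (DL2 _ DRz).1 _ y2 Rzw); last first.
  by apply: L2_2_add2; exact: L2_2_scale2.
by rewrite inner2Dl ?inner2Zl// ?mulrA//; exact: L2_2_scale2.
Qed.

(** [u_adj] is the weak form of the statement that [u] is an adjoint eigenvector for the conjugate
    of [lam]. Pairing [(z - T) (Res z v) = v] with [u] gives [(z - lam) * inner2 (Res z v) u =
    inner2 v u]: a simple pole only. *)
Lemma inner_riesz_adjoint_eigenvector r P v : 0 < r ->
  riesz_projection D T lam r P -> L2_2 v -> inner2 (P v) u = inner2 v u.
Proof.
move=> r_gt0 [Res [Res_resolvent _ PE]] v2; case: (linT) => DL2 _ _.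
rewrite PE// (@circle_integral_pole _ _ _ (inner2 v u) 0) ?mul0r ?addr0//.
move=> z zlam zr; rewrite mulr0 addr0.
have [RzD _ _] := Res_resolvent _ zlam zr; have [DRz zRz] := RzD _ v2.
have [Rz2 TRz2] := DL2 _ DRz.
have zRz2 : L2_2 (add2 (scale2 z (Res z v)) (scale2 (-1) (T (Res z v)))).
  by apply: L2_2_add2; exact: L2_2_scale2.
rewrite -(inner2_aeql zRz2 v2 u2 zRz) inner2Dl// ?inner2Zl//.
- rewrite u_adj// mulN1r -mulrBl mulKf//.
  by rewrite subr_eq0.
- exact: L2_2_scale2.
- exact: L2_2_scale2.
Qed.

Lemma adjoint_eigenvector_eq0 r P : 0 < r -> riesz_projection D T lam r P ->
  has_dim (P @` @L2_2 R) 2 -> k != 0 -> ~ aeq2 v0 (zero2 R) ->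
  aeq2 (T vg) (add2 (scale2 lam vg) (scale2 k v0)) ->
  inner2 v0 u = 0 -> inner2 vg u = 0 -> aeq2 u (zero2 R).
Proof.
move=> r_gt0 rieszP dimP k_neq0 v0_neq0 Tvg v0u vgu.
case: (linT) => DL2 T0 _.
have [v02 Tv02] := DL2 _ Dv0; have [vg2 Tvg2] := DL2 _ Dvg.
have [_ [_ P2 _]] := rieszP.
set c := (2 * 'i%C * pi%:C)^-1 *
  circle_integral lam r (fun z => (z - lam) ^- 2).
have Pv0 : aeq2 (P v0) v0.
  apply: inner2_ext => [||y y2]; [exact: P2|exact: v02|].
  (* For a true eigenvector [l = 0], and the double pole disappears. *)
  rewrite (inner_riesz_generalized (l := 0) r_gt0 rieszP Dv0)// ?mul0r ?addr0//.
  rewrite [X in aeq2 _ X](_ : _ = scale2 lam v0)//.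
  by apply: cfun2_eq => x /=; rewrite mul0r addr0.
have Pvg : aeq2 (P vg) (add2 vg (scale2 (k * c) v0)).
  have kcv02 := L2_2_scale2 (k * c) v02.
  apply: inner2_ext => [||y y2]; [exact: P2|exact: L2_2_add2|].
  rewrite (inner_riesz_generalized r_gt0 rieszP Dvg Tvg)//.
  by rewrite inner2Dl// inner2Zl// -/c mulrAC.
(* The images under [P] are used instead of [v0] and [vg], since these belong to the range of [P]
   only up to a.e. equality and a change of basis. *)
pose f (i : 'I_2) := if i == ord0 then P v0 else P vg.
have fE (d : 'I_2 -> R[i]) :
    lincomb d f = add2 (scale2 (d ord0) (P v0)) (scale2 (d ord_max) (P vg)).
  have -> : ord_max = lift ord0 ord0 :> 'I_2 by exact: val_inj.
  by apply: cfun2_eq => x /=; rewrite big_ord_recl big_ord1 /f /=.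
have f_free (d : 'I_2 -> R[i]) :
    aeq2 (lincomb d f) (zero2 R) -> forall i, d i = 0.
  rewrite fE => df0.
  (* [a] and [b] are the coefficients of the combination with respect to [v0] and [vg]. *)
  set b := d ord_max in df0 *; pose a := d ord0 + b * (k * c).
  have [Dy Ty] := linear_operator2_comb a b Dv0 Dvg.
  set y := add2 _ _ in Dy Ty.
  have y0 : aeq2 y (zero2 R).
    apply: aeq2_trans df0; apply: aeq2_sym.
    apply: (aeq2_trans (aeq2D (aeq2Z _ Pv0) (aeq2Z _ Pvg))).
    rewrite (_ : add2 _ _ = y); first exact: aeq2_refl.
    by apply: cfun2_eq => x /=; rewrite /a; ring.
  have Ty' := aeq2_trans Ty (aeq2D (aeq2Z _ Tv0) (aeq2Z _ Tvg)).
  have Ty0 := aeq2_trans (aeq2_sym Ty') (T0 _ Dy y0).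
  have b0 : b = 0.
    have : aeq2 (scale2 (b * k) v0) (zero2 R).
      (* Applying [T - lam] to [a v0 + b vg = 0] leaves [b k v0 = 0]. *)
      have := aeq2D Ty0 (aeq2Z (- lam) y0).
      have -> : add2 (zero2 R) (scale2 (- lam) (zero2 R)) = zero2 R.
        by apply: cfun2_eq => x /=; rewrite mulr0 addr0.
      rewrite (_ : add2 _ _ = scale2 (b * k) v0)//.
      by apply: cfun2_eq => x /=; ring.
    move=> /aeq2_scale_eq0 /(_ v0_neq0) /eqP.
    by rewrite mulf_eq0 (negbTE k_neq0) orbF => /eqP.
  have a0 : a = 0.
    apply: aeq2_scale_eq0 v0_neq0; rewrite (_ : scale2 a v0 = y)//.
    by apply: cfun2_eq => x /=; rewrite b0 mul0r addr0.
  have d0 : d ord0 = 0 by move: a0; rewrite /a b0 mul0r addr0.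
  by move=> i; case: (unliftP ord0 i) => [j|] ->; rewrite ?d0// (ord1 j) -b0;
    congr d; exact: val_inj.
have L2v (v : cfun2 R) : L2_2 v -> (P @` @L2_2 R) (P v) by move=> v2; exists v.
have Pu : inner2 (P u) u = 0.
  apply: (has_dim_annihilator dimP _ _ f_free u2 _ (L2v _ u2)).
  - by move=> _ [v v2 <-]; exact: P2.
  - by move=> i; rewrite /f; case: ifP => _; exact: L2v.
  - by move=> i; rewrite /f; case: ifP => _;
      rewrite (inner_riesz_adjoint_eigenvector r_gt0 rieszP).
apply: inner2_self_eq0 => //.
by rewrite -(inner_riesz_adjoint_eigenvector r_gt0 rieszP)// Pu.
Qed.

End RieszRange.

(** * Two copies of a self-adjoint operator coupled by a bounded matrix potential *)

Section CoupledOperator.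
Context {R : realType}.
Variables (D0 : set (cfun R)) (L0 : cfun R -> cfun R).
Hypothesis L0_self_adjoint : self_adjoint D0 L0.
Implicit Types (f h k a b c d : cfun R) (u v w : cfun2 R).

Lemma innerDr f h k : L2 f -> L2 h -> L2 k ->
  inner k (fun x => f x + h x) = inner k f + inner k h.
Proof.
move=> f2 h2 k2; rewrite (inner_conj k2 (L2D f2 h2)) innerDl// rmorphD.
by congr (_ + _); exact/esym/inner_conj.
Qed.

Lemma domain_L2 f : D0 f -> L2 f /\ L2 (L0 f).
Proof. by case: L0_self_adjoint => -[+ _ _ _] _ _; apply. Qed.

(** Self-adjointness places [(h, L0 h)] in the graph of the adjoint, whose defining identity is the
    claim. *)
Lemma self_adjoint_symmetric f h : D0 f -> D0 h ->
  inner (L0 f) h = inner f (L0 h).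
Proof.
case: L0_self_adjoint => _ _ adjE Df Dh; have [_ h2] := domain_L2 Dh.
have /adjE[_ _] : [/\ D0 h, L2 (L0 h) & aeq (L0 h) (L0 h)].
  by split=> //; exact: aeW.
exact.
Qed.

Lemma domain_linear (z : R[i]) f h : D0 f -> D0 h ->
  D0 (fun x => z * f x + h x) /\
  aeq (L0 (fun x => z * f x + h x)) (fun x => z * L0 f x + L0 h x).
Proof. by case: L0_self_adjoint => -[_ _ _ +] _ _; apply. Qed.

Lemma domain_aeq0 f : D0 f -> aeq f (fun=> 0) -> aeq (L0 f) (fun=> 0).
Proof.
case: L0_self_adjoint => -[_ D00 aeqD _] _ _ Df f0.
have [_] := aeqD _ _ Df L2_zero f0.
(* Linearity at [-1 * 0 + 0] shows that [L0 0 = - L0 0 + L0 0], which is zero a.e. *)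
have [_] := domain_linear (-1) D00 D00.
rewrite (_ : (fun=> _) = (fun=> 0)); last first.
  by apply/funext => x; rewrite mulr0 addr0.
by apply: ae_eq_imply2 => x ->; rewrite mulN1r addNr.
Qed.

(** Common form of the linearized operator and its adjoint, so that domains, linearity and
    adjunction are treated once. *)
Definition coupled a b c d v : cfun2 R :=
  (fun x => L0 v.1 x + (a x * v.1 x + b x * v.2 x),
   fun x => L0 v.2 x + (c x * v.1 x + d x * v.2 x)).

Lemma L2_2_coupled a b c d v : bounded_mfun a -> bounded_mfun b ->
  bounded_mfun c -> bounded_mfun d -> dom2 D0 v -> L2_2 (coupled a b c d v).
Proof.
move=> ? ? ? ? [/domain_L2[? ?] /domain_L2[? ?]].
by split; apply: L2D => //; apply: L2D; exact: L2M.
Qed.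

(** [L0] is symmetric in each component, and the matrix of multipliers passes to its conjugate
    transpose; hence the exchange of [b] and [c]. *)
Lemma coupled_adjoint a b c d u v : bounded_mfun a -> bounded_mfun b ->
  bounded_mfun c -> bounded_mfun d -> dom2 D0 u -> dom2 D0 v ->
  inner2 (coupled a b c d u) v =
  inner2 u (coupled (fun x => conjc (a x)) (fun x => conjc (c x))
                    (fun x => conjc (b x)) (fun x => conjc (d x)) v).
Proof.
move=> ba bb bc bd [Du1 Du2] [Dv1 Dv2].
have [u1 Lu1] := domain_L2 Du1; have [u2 Lu2] := domain_L2 Du2.
have [v1 Lv1] := domain_L2 Dv1; have [v2 Lv2] := domain_L2 Dv2.
have [ba' bb'] := (bounded_mfun_conj ba, bounded_mfun_conj bb).
have [bc' bd'] := (bounded_mfun_conj bc, bounded_mfun_conj bd).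
rewrite /inner2 /=.
have sum3l f h k l : L2 f -> L2 h -> L2 k -> L2 l ->
    inner (fun x => f x + (h x + k x)) l = inner f l + (inner h l + inner k l).
  by move=> ? ? ? ?; rewrite innerDl ?innerDl//; exact: L2D.
have sum3r f h k l : L2 f -> L2 h -> L2 k -> L2 l ->
    inner l (fun x => f x + (h x + k x)) = inner l f + (inner l h + inner l k).
  by move=> ? ? ? ?; rewrite innerDr ?innerDr//; exact: L2D.
rewrite (sum3l _ _ _ _ Lu1 (L2M ba u1) (L2M bb u2) v1).
rewrite (sum3l _ _ _ _ Lu2 (L2M bc u1) (L2M bd u2) v2).
rewrite (sum3r _ _ _ _ Lv1 (L2M ba' v1) (L2M bc' v2) u1).
rewrite (sum3r _ _ _ _ Lv2 (L2M bb' v1) (L2M bd' v2) u2).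
rewrite !innerMl !self_adjoint_symmetric//.
by ring.
Qed.

Lemma isigma3_coupled_linear a b c d : bounded_mfun a -> bounded_mfun b ->
  bounded_mfun c -> bounded_mfun d ->
  linear_operator2 (dom2 D0) (isigma3 (coupled a b c d)).
Proof.
move=> ba bb bc bd; split.
- move=> v Dv; have [/domain_L2[? _] /domain_L2[? _]] := Dv; split=> //.
  by apply: L2_2_scale2; apply: L2_2_sigma3; exact: L2_2_coupled.
- move=> v [Dv1 Dv2] [v10 v20].
  (* Three a.e. equalities must be combined; pairing two of them brings the situation within reach
     of [ae_eq_imply2]. *)
  have v0 : (fun x => (v.1 x, v.2 x)) = (fun=> (0, 0))
      %[ae @lebesgue_measure R].
    by apply: ae_eq_imply2 v10 v20 => x -> ->.
  split; [apply: ae_eq_imply2 v0 (domain_aeq0 Dv1 v10)|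
          apply: ae_eq_imply2 v0 (domain_aeq0 Dv2 v20)] => x /= [-> ->] ->.
    by rewrite !mulr0 !addr0 mulr0.
  by rewrite !mulr0 !addr0 oppr0 mulr0.
- move=> z u v [Du1 Du2] [Dv1 Dv2].
  have [D1 L1] := domain_linear z Du1 Dv1.
  have [D2 L2] := domain_linear z Du2 Dv2.
  split=> //; split; [apply: ae_eq_imply L1|apply: ae_eq_imply L2]
    => x /= ->; ring.
Qed.

End CoupledOperator.

(** * The linearized operator at a stationary state and its adjoint *)

Section Linearization.
Context {R : realType}.
Implicit Types (phi : cfun R).

(** Measurability comes from [L2]. The exponential factor is at most one, so [C] bounds the modulus
    and with it both parts. *)
Lemma exp_decay_bounded phi : L2 phi -> exp_decay phi -> bounded_mfun phi.
Proof.
move=> [/Lfun2P[mr _] /Lfun2P[mi _]] [C [kappa [C_gt0 kappa_gt0 phiC]]].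
split=> //; exists C => x; have := phiC x.
rewrite normc_def lecR => le_C.
have {}le_C : Num.sqrt (complex.Re (phi x) ^+ 2 + complex.Im (phi x) ^+ 2) <= C.
  apply: (le_trans le_C); rewrite ger_pMr// -expR0 ler_expR.
  by rewrite mulNr oppr_le0 mulr_ge0// ltW.
by split; apply: (le_trans _ le_C);
  rewrite -sqrtr_sqr ler_wsqrtr// ?lerDl ?lerDr sqr_ge0.
Qed.

Variables (D0 : set (cfun R)) (L0 : cfun R -> cfun R).
Variables (W : R -> R) (g mu gamma : R) (phi : cfun R).

(** The squared modulus is written as a product with the conjugate, to which the closure properties
    of [bounded_mfun] and ring reasoning apply. *)
Let diag (s : R[i]) : cfun R := fun x =>
  s * (W x)%:C - mu%:C - 2 * g%:C * (phi x * conjc (phi x)).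
Let offdiag : cfun R := fun x => - g%:C * phi x ^+ 2.

Lemma normc_sqr (z : R[i]) : `|z| ^+ 2 = z * conjc z.
Proof. by rewrite normcE sqr_sqrtc. Qed.

Let conj_offdiag x : conjc (offdiag x) = - g%:C * conjc (phi x) ^+ 2.
Proof.
rewrite /offdiag rmorphM rmorphXn; congr (_ * _).
by rewrite -rmorphN; exact: conjc_real.
Qed.

Lemma linearizedE v : linearized L0 W g mu gamma phi v =
  coupled L0 (diag ('i%C * gamma%:C)) offdiag (fun x => conjc (offdiag x))
    (diag (- 'i%C * gamma%:C)) v.
Proof.
apply: cfun2_eq => x /=; rewrite /diag /offdiag normc_sqr.
  by ring.
rewrite conj_offdiag; ring.
Qed.

Lemma linearized_adjE v : linearized_adj L0 W g mu gamma phi v =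
  coupled L0 (diag (- 'i%C * gamma%:C)) offdiag (fun x => conjc (offdiag x))
    (diag ('i%C * gamma%:C)) v.
Proof.
apply: cfun2_eq => x /=; rewrite /diag /offdiag normc_sqr.
  by ring.
rewrite conj_offdiag; ring.
Qed.

Lemma conj_diag s : (fun x => conjc (diag s x)) = diag (conjc s).
Proof.
apply/funext => x; rewrite /diag !rmorphB !rmorphM rmorph_nat /= conjcK.
congr (_ * _ - _ - _ * _ * _); try exact: conjc_real.
exact: mulrC.
Qed.

Hypothesis L0_self_adjoint : self_adjoint D0 L0.
Hypothesis W_meas : measurable_fun [set: R] W.
Hypothesis W_bounded : exists M : R, forall x, `|W x| <= M.
Hypothesis phi_bounded : bounded_mfun phi.

Lemma bounded_diag s : bounded_mfun (diag s).
Proof.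
case: W_bounded => M WM.
have bN f : bounded_mfun f -> bounded_mfun (fun x => - f x).
  move=> bf; under eq_fun do rewrite -mulN1r.
  by apply: bounded_mfunM => //; exact: bounded_mfun_cst.
have bW := bounded_mfun_real W_meas WM.
apply: bounded_mfunD; first apply: bounded_mfunD.
- by apply: bounded_mfunM => //; exact: bounded_mfun_cst.
- exact: bounded_mfun_cst.
- apply: bN; apply: bounded_mfunM; first exact: bounded_mfun_cst.
  by apply: bounded_mfunM => //; exact: bounded_mfun_conj.
Qed.

Lemma bounded_offdiag : bounded_mfun offdiag.
Proof.
apply: bounded_mfunM; first exact: bounded_mfun_cst.
exact: bounded_mfunM.
Qed.

(** Conjugate transposition preserves the off-diagonal entries, which are conjugate to each other.
    On the diagonal it only reverses the sign of [i gamma W], the other terms being real. *)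
Lemma linearized_adjoint u v : dom2 D0 u -> dom2 D0 v ->
  inner2 (linearized L0 W g mu gamma phi u) v =
  inner2 u (linearized_adj L0 W g mu gamma phi v).
Proof.
move=> Du Dv; have bd := bounded_diag; have bo := bounded_offdiag.
have bo' := bounded_mfun_conj bo.
rewrite linearizedE linearized_adjE (coupled_adjoint L0_self_adjoint)//.
have iJ : conjc ('i%C * gamma%:C) = - 'i%C * gamma%:C.
  rewrite rmorphM; congr (_ * _); last exact: conjc_real.
  by apply/eqP; rewrite eq_complex /= oppr0 !eqxx.
have iNJ : conjc (- 'i%C * gamma%:C) = 'i%C * gamma%:C by rewrite -iJ conjcK.
rewrite !conj_diag iJ iNJ.
by under [fun x => conjc (conjc _)]eq_fun do rewrite conjcK.
Qed.

Lemma isigma3_linearized_linear :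
  linear_operator2 (dom2 D0) (isigma3 (linearized L0 W g mu gamma phi)).
Proof.
have -> : linearized L0 W g mu gamma phi = coupled L0 (diag ('i%C * gamma%:C))
    offdiag (fun x => conjc (offdiag x)) (diag (- 'i%C * gamma%:C)).
  by apply/funext => v; rewrite linearizedE.
exact: (isigma3_coupled_linear L0_self_adjoint (bounded_diag _)
  bounded_offdiag (bounded_mfun_conj bounded_offdiag) (bounded_diag _)).
Qed.

Lemma L2_2_linearized v : dom2 D0 v ->
  L2_2 (linearized L0 W g mu gamma phi v).
Proof.
move=> Dv; rewrite linearizedE; exact: (L2_2_coupled
  L0_self_adjoint (bounded_diag _) bounded_offdiag
  (bounded_mfun_conj bounded_offdiag) (bounded_diag _) Dv).
Qed.

Lemma L2_2_linearized_adj v : dom2 D0 v ->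
  L2_2 (linearized_adj L0 W g mu gamma phi v).
Proof.
move=> Dv; rewrite linearized_adjE; exact: (L2_2_coupled
  L0_self_adjoint (bounded_diag _) bounded_offdiag
  (bounded_mfun_conj bounded_offdiag) (bounded_diag _) Dv).
Qed.

End Linearization.

(** * Vanishing Krein quantity and nondegenerate pairing at a defective eigenvalue *)

Theorem lemma6 (R : realType) (V W : R -> R) (g mu : R)
  (D0 : set (cfun R)) (L0 : cfun R -> cfun R)
  (gamma_star : R) (Phi : R -> cfun R)
  (V_meas : measurable_fun [set: R] V)
  (W_meas : measurable_fun [set: R] W)
  (V_even : forall x, V (- x) = V x)
  (W_odd : forall x, W (- x) = - W x)
  (g_sign : g = 1 \/ g = - 1)
  (L0_self_adjoint : self_adjoint D0 L0)
  (L0_extends : extends_schrodinger V D0 L0)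
  (W_bounded : exists M : R, forall x, `|W x| <= M)
  (W_decay : exists C kappa : R, [/\ 0 < C, 0 < kappa
     & forall x, `|W x| <= C * expR (- kappa * `|x|)])
  (gamma_star_gt0 : 0 < gamma_star)
  (Phi_solution : forall gamma : R, gamma \in `]- gamma_star, gamma_star[ ->
     [/\ D0 (Phi gamma),
         stationary L0 W g mu gamma (Phi gamma),
         forall x, Phi gamma x = conjc (Phi gamma (- x))
       & exp_decay (Phi gamma)])
  (Phi_analytic : real_analytic_in_domain D0 L0 gamma_star Phi)
  (gamma0 Omega0 : R)
  (gamma0_in : gamma0 \in `]- gamma_star, gamma_star[)
  (Omega0_neq0 : Omega0 != 0)
  (v0 vg v0s vgs : cfun2 R) :
  let L := linearized L0 W g mu gamma0 (Phi gamma0) in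
  let Ls := linearized_adj L0 W g mu gamma0 (Phi gamma0) in
  let lambda0 : R[i] := 'i%C * Omega0%:C in
  isolated_defective_eigenvalue D0 L lambda0 1 2 ->
  isolated_defective_eigenvalue D0 Ls lambda0 1 2 ->
  dom2 D0 v0 -> dom2 D0 vg -> dom2 D0 v0s -> dom2 D0 vgs ->
  ~ aeq2 v0 (zero2 R) -> ~ aeq2 v0s (zero2 R) ->
  aeq2 (L v0) (scale2 Omega0%:C (sigma3 v0)) ->
  aeq2 (L vg) (add2 (scale2 Omega0%:C (sigma3 vg)) (sigma3 v0)) ->
  aeq2 (Ls v0s) (scale2 Omega0%:C (sigma3 v0s)) ->
  aeq2 (Ls vgs) (add2 (scale2 Omega0%:C (sigma3 vgs)) (sigma3 v0s)) ->
  krein_quantity v0 v0s = 0 /\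
  inner2 vg (sigma3 v0s) = inner2 v0 (sigma3 vgs) /\
  inner2 vg (sigma3 v0s) != 0.
Proof.
move=> L Ls lambda0 [_ _ _ _ [r [P [r_gt0 rieszP dimP]]]] _.
move=> Dv0 Dvg Dv0s Dvgs v0_neq0 v0s_neq0 Lv0 Lvg Lsv0s Lsvgs.
have [Dphi _ _ phi_decay] := Phi_solution _ gamma0_in.
have phi_bounded :=
  exp_decay_bounded (domain_L2 L0_self_adjoint Dphi).1 phi_decay.
have dom2_L2 v : dom2 D0 v -> L2_2 v.
  by case=> /(domain_L2 L0_self_adjoint)[? _] /(domain_L2 L0_self_adjoint)[? _].
have [v02 vg2] := (dom2_L2 _ Dv0, dom2_L2 _ Dvg).
have [v0s2 vgs2] := (dom2_L2 _ Dv0s, dom2_L2 _ Dvgs).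
have [Sv02 Svg2] := (L2_2_sigma3 v02, L2_2_sigma3 vg2).
have [Sv0s2 Svgs2] := (L2_2_sigma3 v0s2, L2_2_sigma3 vgs2).
have LL2 v : dom2 D0 v -> L2_2 (L v) by exact: L2_2_linearized.
have LsL2 v : dom2 D0 v -> L2_2 (Ls v) by exact: L2_2_linearized_adj.
have adj u v : dom2 D0 u -> dom2 D0 v -> inner2 (L u) v = inner2 u (Ls v).
  exact: linearized_adjoint.
(* [lambda0] is purely imaginary, so [Omega0] leaves either slot of the inner product unchanged; the
   cancellations below rest on this. *)
have OmegaJ : conjc Omega0%:C = Omega0%:C by exact: conjc_real.
have inner_Lvg w : L2_2 w ->
    inner2 (L vg) w = Omega0%:C * inner2 vg (sigma3 w) + inner2 v0 (sigma3 w).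
  move=> w2; rewrite (inner2_aeql (LL2 _ Dvg) _ w2 Lvg); last first.
    by apply: L2_2_add2 => //; exact: L2_2_scale2.
  by rewrite inner2Dl ?inner2Zl ?inner2_sigma3//; exact: L2_2_scale2.
have inner_Lsv0s w : L2_2 w ->
    inner2 w (Ls v0s) = Omega0%:C * inner2 w (sigma3 v0s).
  move=> w2; rewrite (inner2_aeqr (LsL2 _ Dv0s) _ w2 Lsv0s).
    by rewrite inner2Zr// OmegaJ.
  exact: L2_2_scale2.
have inner_Lsvgs w : L2_2 w -> inner2 w (Ls vgs) =
    Omega0%:C * inner2 w (sigma3 vgs) + inner2 w (sigma3 v0s).
  move=> w2; rewrite (inner2_aeqr (LsL2 _ Dvgs) _ w2 Lsvgs); last first.
    by apply: L2_2_add2 => //; exact: L2_2_scale2.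
  by rewrite inner2Dr ?inner2Zr ?OmegaJ//; exact: L2_2_scale2.
(* Both evaluations contain [Omega0 * inner2 vg (sigma3 v0s)]; the Krein quantity is the only other
   term. *)
have krein0 : inner2 v0 (sigma3 v0s) = 0.
  have := adj vg v0s Dvg Dv0s; rewrite inner_Lvg// inner_Lsv0s//.
  by rewrite -[RHS]addr0 => /addrI.
split=> //; split.
  have := adj vg vgs Dvg Dvgs; rewrite inner_Lvg// inner_Lsvgs//.
  by move=> /addrI.
apply/eqP => vgu; apply: v0s_neq0.
have linT := isigma3_linearized_linear g mu gamma0 L0_self_adjoint W_meas
  W_bounded phi_bounded.
have i_neq0 : 'i%C != 0 :> R[i] by rewrite eq_complex /= oner_eq0 andbF.
have Tv0 : aeq2 (isigma3 L v0) (scale2 lambda0 v0).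
  apply: (aeq2_trans (aeq2Z _ (aeq2_sigma3 Lv0))).
  rewrite [X in aeq2 X _](_ : _ = scale2 lambda0 v0); first exact: aeq2_refl.
  by apply: cfun2_eq => x /=; rewrite /lambda0; ring.
(* The factor ['i] in [isigma3] makes the chain constant [k] equal to ['i]. *)
have Tvg : aeq2 (isigma3 L vg) (add2 (scale2 lambda0 vg) (scale2 'i%C v0)).
  apply: (aeq2_trans (aeq2Z _ (aeq2_sigma3 Lvg))).
  rewrite [X in aeq2 X _](_ : _ = add2 (scale2 lambda0 vg) (scale2 'i%C v0)).
    exact: aeq2_refl.
  by apply: cfun2_eq => x /=; rewrite /lambda0; ring.
(* The two [sigma3] cancel, which leaves ['i * inner2 (L v) v0s]; moving [L] across gives the
   eigenvalue. *)
have u_adj v : dom2 D0 v ->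
    inner2 (isigma3 L v) (sigma3 v0s) = lambda0 * inner2 v (sigma3 v0s).
  move=> Dv; have Lv2 := LL2 _ Dv; have SLv2 := L2_2_sigma3 Lv2.
  rewrite /isigma3 inner2Zl// inner2_sigma3 sigma3K adj// inner_Lsv0s ?mulrA//.
  exact: dom2_L2.
have Sv0s0 := adjoint_eigenvector_eq0 linT Dv0 Dvg Sv0s2 Tv0 u_adj r_gt0 rieszP
  dimP i_neq0 v0_neq0 Tvg krein0 vgu.
have := aeq2_sigma3 Sv0s0; rewrite sigma3K.
by rewrite (_ : sigma3 (zero2 R) = zero2 R)//; apply: cfun2_eq => x //=;
  rewrite oppr0.
Qed.
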